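(* Let $G$ be a group and $(\theta,\mathcal S)\in\mathsf{pA}(G,\mathsf{Sem})$ such that for all $x\in G$ the domain $D_x$ is an ideal of $S$ and $\mathcal D_x$ is unital, that is, $D_x=1_xS$ for some central idempotent $1_x\in S$. For $[x,s],[y,t]\in S^U$ set $$[x,s]*[y,t]=[x,\,s\,(x^{-1}y)(1_{y^{-1}x}t)],$$ where $s\,(x^{-1}y)(1_{y^{-1}x}t)$ means $s\cdot\theta_{x^{-1}y}(1_{y^{-1}x}\cdot t)$. Then $*$ is a well-defined associative operation on $S^U$. Moreover, $(\theta^U,(S^U,* ))$, with the map $s\mapsto[1,s]$, is a (non-universal) globalization of $(\theta,\mathcal S)$ in $\mathsf A(G,\mathsf{Sem})$, and $[1,S]=\{[1,s]\mid s\in S\}$ is a (unital) ideal of $(S^U,* )$.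
   Context: A partial action of a group $G$ on a set $S$ is a partial map $\theta:G\times S\dashrightarrow S$ such that for all $x,y\in G$, $a\in S$: (i) $\theta(1,a)$ is defined and equals $a$; (ii) if $\theta(x,a)$ is defined, then $\theta(x^{-1},\theta(x,a))$ is defined and equals $a$; (iii) if $\theta(y,a)$ and $\theta(x,\theta(y,a))$ are defined, then $\theta(xy,a)$ is defined and equals $\theta(x,\theta(y,a))$. It is global if everywhere defined. One writes $xa$ or $x(a)$ for $\theta(x,a)$. The domain $D_x$ is $\{\theta(x,a)\mid a\in S,\ \theta(x,a)\text{ defined}\}$, and $\theta_x=\theta(x,-)$ is a bijection $D_{x^{-1}}\to D_x$. $S^U=(G\times S)/{\sim}$, where $(x,s)\sim(y,t)$ iff $(y^{-1}x)s$ is defined and equals $t$; $[x,s]$ is the class of $(x,s)$; $\theta^U$ is the global action $x[y,s]=[xy,s]$ of $G$ on $S^U$. $\mathsf{Sem}$ is the variety of semigroups. $\mathsf{pA}(G,\mathsf{Sem})$ is the category of pairs $(\theta,\mathcal S)$ with $\mathcal S=(S,\cdot)$ a semigroup and $\theta$ a partial action of $G$ on the set $S$ such that every $D_x$ is a subsemigroup $\mathcal D_x$ of $\mathcal S$ and every $\theta_x:\mathcal D_{x^{-1}}\to\mathcal D_x$ is an isomorphism of semigroups. Morphisms $(\theta,\mathcal S)\to(\theta',\mathcal S')$ are semigroup homomorphisms $\varphi$ such that whenever $\theta(x,a)$ is defined, $\theta'(x,\varphi(a))$ is defined and equals $\varphi(\theta(x,a))$. $\mathsf A(G,\mathsf{Sem})$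 is the full subcategory of pairs with global $\theta$. A globalization of $(\theta,\mathcal S)$ in $\mathsf A(G,\mathsf{Sem})$ is $(\vartheta,\mathcal T)\in\mathsf A(G,\mathsf{Sem})$ with an injective morphism $\iota:(\theta,\mathcal S)\to(\vartheta,\mathcal T)$ such that for all $x\in G$, $a\in S$: $\theta(x,a)$ is defined iff $\vartheta(x,\iota(a))\in\iota(S)$. It is universal if every globalization of $(\theta,\mathcal S)$ in $\mathsf A(G,\mathsf{Sem})$ factors through it by a unique morphism. Ideals are two-sided; an ideal is unital if it has an identity element as a semigroup. *)

(* Defs.v *)
From HB Require Import structures.
From mathcomp Require Import all_boot.
From mathcomp Require Import generic_quotient.
From mathcomp Require Import boolp classical_sets functions.

Set Implicit Arguments.
Unset Strict Implicit.
Unset Printing Implicit Defensive.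

Local Open Scope classical_set_scope.
Local Open Scope group_scope.
Local Open Scope quotient_scope.

(* [theta x a = None] means that theta(x,a) is undefined. *)
Record partial_action (G : groupType) (S : Type) := PartialAction {
  pact :> G -> S -> option S;
  pact1 : forall a, pact 1 a = Some a;
  pactV : forall x a b, pact x a = Some b -> pact x^-1 b = Some a;
  pactM : forall x y a b c,
    pact y a = Some b -> pact x b = Some c -> pact (x * y) a = Some c }.

Definition pdom (G : groupType) (S : Type) (theta : partial_action G S)
    (x : G) : set S :=
  [set b | exists a, theta x a = Some b].

Definition is_global (G : groupType) (S : Type) (theta : partial_action G S) :=
  forall x a, exists b, theta x a = Some b.

Section SetGlobalization.
Context {G : groupType} {S : choiceType} (theta : partial_action G S).

Definition SU_rel (p q : G * S) : bool := theta (q.1^-1 * p.1) p.2 == Some q.2.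

Lemma SU_rel_refl : reflexive SU_rel.
Proof. by move=> [x s]; rewrite /SU_rel /= mulVg pact1. Qed.

Lemma SU_rel_sym : symmetric SU_rel.
Proof.
suff H p q : SU_rel p q -> SU_rel q p by move=> p q; apply/idP/idP; exact: H.
move=> /eqP H; have := pactV H; rewrite /SU_rel invgM invgK => ->.
exact: eqxx.
Qed.

Lemma SU_rel_trans : transitive SU_rel.
Proof.
move=> q p r /eqP Hpq /eqP Hqr; apply/eqP.
by have := pactM Hpq Hqr; rewrite mulgA -(mulgA r.1^-1) mulgV mulg1.
Qed.

Definition SU_equiv : equiv_rel (G * S)%type :=
  EquivRel SU_rel SU_rel_refl SU_rel_sym SU_rel_trans.

Definition SU : choiceType := {eq_quot SU_equiv}.

Definition SU_class (x : G) (s : S) : SU := \pi_{eq_quot SU_equiv} (x, s).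

Lemma SU_classP x s y t :
  SU_class x s = SU_class y t <-> theta (y^-1 * x) s = Some t.
Proof.
split; first by move=> /eqmodP /eqP.
by move=> H; apply/eqmodP/eqP.
Qed.

Definition SU_act_fun (x : G) (q : SU) : SU :=
  let: (y, s) := repr (q : {eq_quot SU_equiv}) in SU_class (x * y) s.

Lemma SU_act_funE x y s : SU_act_fun x (SU_class y s) = SU_class (x * y) s.
Proof.
rewrite /SU_act_fun.
case E: (repr _) => [z t]; apply/SU_classP.
have /SU_classP H : SU_class z t = SU_class y s.
  by rewrite /SU_class -E reprK.
by rewrite invgM -mulgA (mulgA x^-1) mulVg mul1g.
Qed.

Lemma SU_ind (P : SU -> Prop) : (forall x s, P (SU_class x s)) -> forall q, P q.
Proof.
move=> H q; rewrite -(reprK (q : {eq_quot SU_equiv})).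
by case: (repr _) => x s; exact: H.
Qed.

Lemma SU_act1 q : Some (SU_act_fun 1 q) = Some q.
Proof. by elim/SU_ind: q => x s; rewrite SU_act_funE mul1g. Qed.

Lemma SU_actV x q r :
  Some (SU_act_fun x q) = Some r -> Some (SU_act_fun x^-1 r) = Some q.
Proof.
by move=> [<-]; elim/SU_ind: q => y s; rewrite !SU_act_funE mulgA mulVg mul1g.
Qed.

Lemma SU_actM x y p q r : Some (SU_act_fun y p) = Some q ->
  Some (SU_act_fun x q) = Some r -> Some (SU_act_fun (x * y) p) = Some r.
Proof.
by move=> [<-] [<-]; elim/SU_ind: p => z s; rewrite !SU_act_funE mulgA.
Qed.

Definition SU_act : partial_action G SU :=
  @PartialAction G SU (fun x q => Some (SU_act_fun x q)) SU_act1 SU_actV SU_actM.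

Definition SU_inj (s : S) : SU := SU_class 1 s.

End SetGlobalization.

Definition SU_semigroup (G : groupType) (S : choiceType)
    (theta : partial_action G S) (op : SU theta -> SU theta -> SU theta)
    (opA : associative op) : semigroupType :=
  HB.pack (Choice.sort (SU theta)) (isSemigroup.Build (SU theta) opA).

Definition subsemigroup (S : semigroupType) (A : set S) :=
  forall a b, A a -> A b -> A (a * b).

Definition ideal (S : semigroupType) (I : set S) :=
  forall a s, I a -> I (a * s) /\ I (s * a).

Definition unital (S : semigroupType) (A : set S) :=
  exists2 e, A e & forall a, A a -> e * a = a /\ a * e = a.

Definition central_idempotent (S : semigroupType) (e : S) :=
  e * e = e /\ forall s : S, commute e s.

Definition partial_iso (S : semigroupType) (f : S -> option S) (A B : set S) :=
  set_bij A (Some @` B) f /\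
  forall a a' b b', A a -> A a' -> f a = Some b -> f a' = Some b' ->
    f (a * a') = Some (b * b').

(* Objects of pA(G,Sem); those of A(G,Sem) are the ones that are [is_global]. *)
Definition in_pA (G : groupType) (S : semigroupType)
    (theta : partial_action G S) :=
  (forall x, subsemigroup (pdom theta x)) /\
  (forall x, partial_iso (theta x) (pdom theta x^-1) (pdom theta x)).

Definition in_A (G : groupType) (S : semigroupType)
    (theta : partial_action G S) :=
  in_pA theta /\ is_global theta.

Definition is_morphism (G : groupType) (S T : semigroupType)
    (theta : partial_action G S) (theta' : partial_action G T) (phi : S -> T) :=
  {morph phi : a b / a * b} /\
  forall x a b, theta x a = Some b -> theta' x (phi a) = Some (phi b).

Definition is_globalization (G : groupType) (S T : semigroupType)
    (theta : partial_action G S) (vtheta : partial_action G T)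
    (iota : S -> T) :=
  [/\ in_A vtheta, is_morphism theta vtheta iota, injective iota &
    forall x a, (exists b, theta x a = Some b) <->
                (exists2 c, vtheta x (iota a) = Some c & range iota c)].

Definition is_universal_globalization (G : groupType) (S T : semigroupType)
    (theta : partial_action G S) (vtheta : partial_action G T)
    (iota : S -> T) :=
  is_globalization theta vtheta iota /\
  forall (T' : semigroupType) (vtheta' : partial_action G T') (iota' : S -> T'),
    is_globalization theta vtheta' iota' ->
    exists! psi : T -> T',
      is_morphism vtheta vtheta' psi /\ forall a, psi (iota a) = iota' a.

Definition unital_ideal_domains (G : groupType) (S : semigroupType)
    (theta : partial_action G S) :=
  forall x, ideal (pdom theta x) /\ unital (pdom theta x).

Definition generates_domain (G : groupType) (S : semigroupType)
    (theta : partial_action G S) (x : G) (e : S) :=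
  central_idempotent e /\ pdom theta x = [set e * s | s in [set: S]].

(* The existence of [u] says that the partial action is defined where the
   formula for the product applies it. As every element of [SU theta] is a
   class, at most one [op] satisfies this, and one does exactly when the formula
   is independent of the representatives. *)
Definition star_formula (G : groupType) (S : semigroupType)
    (theta : partial_action G S) (one : G -> S)
    (op : SU theta -> SU theta -> SU theta) :=
  forall x s y t, exists2 u,
    theta (x^-1 * y) (one (y^-1 * x) * t) = Some u &
    op (SU_class theta x s) (SU_class theta y t) = SU_class theta x (s * u).

(* Main.v *)
From HB Require Import structures.
Require Import Defs.
From mathcomp Require Import all_boot.
From mathcomp Require Import generic_quotient.
From mathcomp Require Import boolp classical_sets functions.

(** The idea is to realise S^U inside a semigroup that is associative for
    trivial reasons.  Since [D_(x^-1)] is generated by the central idempotent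
    [1_(x^-1)], the partial bijection [theta_x] extends to a total map
    [alpha_x s = theta_x (1_(x^-1) s)], an endomorphism of the semigroup S.  In
    these terms the product is [[x,s] * [y,t] = [x, s alpha_(x^-1 y)(t)]].

    Suppose a globalization contains S as the ideal generated by a central
    idempotent.  Then every point p has, for each g in G, a coordinate in S:
    translate p by [g^-1] and project to S.  For p = [x,s] this coordinate has
    to be [alpha_(g^-1 x)(s)].  Read as a definition, the formula gives a map
    from S^U to the direct power S^G.  It respects the relation defining S^U, it
    is injective ([coord_inj]), and it turns the product formula into the
    pointwise product ([coord_star]).  So the formula is independent of
    representatives and associative because this holds in S^G, and G acts by
    automorphisms because it permutes the coordinates.  All of this rests on two
    rules, [alpha_x(1_y) = 1_x 1_(xy)] and
    [alpha_x(alpha_y(s)) = 1_x alpha_(xy)(s)] ([alpha_one], [alpha_comp]).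

    Universality fails because the product forces [1,s] * [g,t] into [1,D_g] for
    every g, whereas in other globalizations the product of an element of S with
    an element of the translate gS need not come from [D_g].  Take S = {0,1}
    under conjunction, with [D_x = {0}] for all x <> 1 in a nontrivial group G.
    Then [1,1] * [g,1] = [1,0] for g <> 1.  On the other hand G acts by
    translations on the left zero semigroup on the set G with a zero adjoined,
    and S embeds there as {0, 1_G}.  The product of [1_G] with its translate g
    is [1_G], which is not 0. *)

Set Implicit Arguments.
Unset Strict Implicit.
Unset Printing Implicit Defensive.

Local Open Scope classical_set_scope.
Local Open Scope group_scope.
Local Open Scope quotient_scope.

(** * Partial actions by partial isomorphisms *)

Section PartialActions.
Context {G : groupType} {S : semigroupType} (theta : partial_action G S).

Lemma pact_pdom x a b : theta x a = Some b -> pdom theta x b.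
Proof. by exists a. Qed.

Lemma pact_pdomV x a b : theta x a = Some b -> pdom theta x^-1 a.
Proof. by move=> ab; exact: pact_pdom (pactV ab). Qed.

Lemma pdomV_pact x a : pdom theta x^-1 a -> exists b, theta x a = Some b.
Proof. by move=> [b ba]; exists b; rewrite -(pactV ba) invgK. Qed.

(** The bijection between the domains comes from the inverse [theta x^-1] of
    [theta x], and multiplicativity makes each domain, being the range of
    [theta x], a subsemigroup. *)
Lemma in_pA_morph :
  (forall x a a' b b', theta x a = Some b -> theta x a' = Some b' ->
     theta x (a * a') = Some (b * b')) ->
  in_pA theta.
Proof.
move=> thetaM; split=> [x b b' [a ab] [a' ab']|x].
  by exists (a * a'); exact: thetaM.
split; last by move=> a a' b b' _ _; exact: thetaM.
split.
- by move=> a /pdomV_pact[b ab]; exists b => //; exists a.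
- move=> a a' /set_mem /pdomV_pact[b ab] _; rewrite ab => /esym a'b.
  by apply: Some_inj; rewrite -(pactV ab) -(pactV a'b).
- by move=> _ [b [a ab] <-]; exists a => //; exact: pact_pdomV ab.
Qed.

Lemma global_in_A (f : G -> S -> S) :
  (forall x a, theta x a = Some (f x a)) ->
  (forall x, {morph f x : a b / a * b}) -> in_A theta.
Proof.
move=> thetaE fM; split; last by move=> x a; exists (f x a).
by apply: in_pA_morph => x a a' b b'; rewrite !thetaE fM => -[->] [->].
Qed.

Lemma pactM_in_pA x a a' b b' : in_pA theta ->
  theta x a = Some b -> theta x a' = Some b' -> theta x (a * a') = Some (b * b').
Proof.
move=> [_ /(_ x)[_ thetaM]] ab ab'.
apply: (thetaM _ _ _ _ _ _ ab ab'); first exact: pact_pdomV ab.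
exact: pact_pdomV ab'.
Qed.

End PartialActions.

(** The identity [e] of an ideal is central in the whole semigroup: for every
    [s] both [e * s] and [s * e] lie in the ideal, so both equal [e * s * e]. *)
Lemma unital_ideal_generated (S : semigroupType) (I : set S) :
  ideal I -> unital I ->
  exists e, central_idempotent e /\ I = [set e * s | s in [set: S]].
Proof.
move=> idI [e Ie eP]; exists e; split.
  split=> [|s]; first by case: (eP e Ie).
  have [Ies Ise] := idI e s Ie.
  by rewrite /commute -(eP _ Ies).2 -(eP _ Ise).1 mulgA.
apply/seteqP; split=> [a Ia|_ [s _ <-]]; first by exists a => //; case: (eP a Ia).
by case: (idI e s Ie).
Qed.

(** * The endomorphisms extending a partial action with unital domains *)

Section UnitalDomains.
Context {G : groupType} {S : semigroupType} (theta : partial_action G S).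
Context (pA : in_pA theta) (one : G -> S).
Context (oneP : forall x, generates_domain theta x (one x)).

Lemma oneC x s : one x * s = s * one x.
Proof. by case: (oneP x) => -[_ +] _; apply. Qed.

Lemma oneCA x s t : s * (one x * t) = one x * (s * t).
Proof. by rewrite mulgA -oneC -mulgA. Qed.

Lemma one_idem x : one x * one x = one x.
Proof. by case: (oneP x) => -[]. Qed.

Lemma pdom_oneM x s : pdom theta x (one x * s).
Proof. by case: (oneP x) => _ ->; exists s. Qed.

Lemma one_pdom x s : pdom theta x s -> one x * s = s.
Proof. by case: (oneP x) => _ -> [t _ <-]; rewrite mulgA one_idem. Qed.

Lemma pdom1 s : pdom theta 1 s.
Proof. by exists s; rewrite pact1. Qed.

Lemma one1M s : one 1 * s = s.
Proof. exact: one_pdom (pdom1 s). Qed.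

Definition alpha x s := odflt s (theta x (one x^-1 * s)).

Lemma pact_alpha x s : theta x (one x^-1 * s) = Some (alpha x s).
Proof. by rewrite /alpha; have [b ->] := pdomV_pact (pdom_oneM x^-1 s). Qed.

Lemma one_pact x s t : theta x s = Some t -> one x^-1 * s = s.
Proof. by move=> /pact_pdomV/one_pdom. Qed.

Lemma pactE x s t : theta x s = Some t -> alpha x s = t.
Proof. by move=> st; apply: Some_inj; rewrite -pact_alpha (one_pact st). Qed.

Lemma pdom_alpha x s : pdom theta x (alpha x s).
Proof. exact: pact_pdom (pact_alpha x s). Qed.

Lemma one_alpha x s : one x * alpha x s = alpha x s.
Proof. exact: one_pdom (pdom_alpha x s). Qed.

Lemma alpha1 s : alpha 1 s = s.
Proof. by apply: pactE; rewrite pact1. Qed.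

Lemma alphaM x : {morph alpha x : s t / s * t}.
Proof.
move=> s t; apply: Some_inj.
rewrite -(pactM_in_pA pA (pact_alpha x s) (pact_alpha x t)) -pact_alpha.
by rewrite -mulgA oneCA !mulgA one_idem.
Qed.

(** The bijection [theta x] maps [D_(x^-1) `&` D_y] onto [D_x `&` D_(xy)], so it
    matches the identity elements of these two subsemigroups. *)
Lemma alpha_one x y : alpha x (one y) = one x * one (x * y).
Proof.
have xy_dom v w : theta x v = Some w -> pdom theta y v ->
    pdom theta (x * y) w.
  by move=> vw [r rv]; exists r; exact: pactM rv vw.
have inxy : pdom theta (x * y) (alpha x (one y)).
  by apply: xy_dom (pact_alpha x (one y)) _; rewrite oneC; exact: pdom_oneM.
set w := one x * one (x * y).
have [v vw] : pdom theta x w by exact: pdom_oneM.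
have vwE := pactE vw.
have yv : pdom theta y v.
  have [r rw] : pdom theta (x * y) w by rewrite /w oneC; exact: pdom_oneM.
  by exists r; have := pactM rw (pactV vw); rewrite mulgA mulVg mul1g.
rewrite -[w in RHS]vwE -(one_pdom yv) alphaM vwE /w.
by rewrite oneCA -oneC (one_pdom inxy) one_alpha.
Qed.

Lemma alpha_oneM x y s : alpha x (one y * s) = one (x * y) * alpha x s.
Proof. by rewrite alphaM alpha_one -mulgA oneCA one_alpha. Qed.

(** On [r = 1_(y^-1) 1_((xy)^-1) s] both [theta y] and [theta (x * y)] are
    defined, so the axioms of a partial action give [theta_x (theta_y r) = theta_(xy) r];
    [alpha_oneM] computes what the idempotents in [r] become on either side. *)
Lemma alpha_comp x y s : alpha x (alpha y s) = one x * alpha (x * y) s.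
Proof.
pose r := one y^-1 * (one (x * y)^-1 * s).
have ry : theta y r = Some (alpha y (one (x * y)^-1 * s)) by exact: pact_alpha.
have rxy : theta (x * y) r = Some (alpha (x * y) (one y^-1 * s)).
  by rewrite /r oneCA pact_alpha.
have := pactM (pactV ry) rxy; rewrite mulgK => /pactE.
by rewrite !alpha_oneM invgM mulVKg mulgV one1M mulgK.
Qed.

(** * Coordinates embedding S^U in a direct power of S *)

Lemma coord_rel g x y s t : theta (y^-1 * x) s = Some t ->
  alpha (g^-1 * x) s = alpha (g^-1 * y) t.
Proof.
move=> st; rewrite -(pactE st) alpha_comp mulgA mulgK.
by rewrite -{1}(one_pact st) alpha_oneM invgM invgK mulgA mulgK.
Qed.

Definition coord (p : SU theta) (g : G) : S :=
  let: (x, s) := repr (p : {eq_quot SU_equiv theta}) in alpha (g^-1 * x) s.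

Lemma coord_class x s g : coord (SU_class theta x s) g = alpha (g^-1 * x) s.
Proof.
rewrite /coord; case E: (repr _) => [y t].
have /SU_classP/coord_rel -> // : SU_class theta y t = SU_class theta x s.
by rewrite /SU_class -E reprK.
Qed.

(** Only the two coordinates at [x] and [y] are needed: they say that
    [alpha (x^-1 * y) t = s], so that [s] lies in the domain, and that
    [alpha (y^-1 * x) s = t]. *)
Lemma coord_inj : injective coord.
Proof.
move=> p q; elim/(@SU_ind _ _ theta): p => x s.
elim/(@SU_ind _ _ theta): q => y t eq_coord.
have := congr1 (@^~ x) eq_coord; rewrite !coord_class mulVg alpha1 => sE.
have := congr1 (@^~ y) eq_coord; rewrite !coord_class mulVg alpha1 => <-.
apply/SU_classP; rewrite -pact_alpha invgM invgK one_pdom // sE.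
exact: pdom_alpha.
Qed.

Lemma coord_mul x s y t g :
  coord (SU_class theta x (s * alpha (x^-1 * y) t)) g =
  alpha (g^-1 * x) s * alpha (g^-1 * y) t.
Proof.
by rewrite coord_class alphaM alpha_comp oneCA mulgA one_alpha mulgA mulgK.
Qed.

Definition star (p q : SU theta) : SU theta :=
  let: (x, s) := repr (p : {eq_quot SU_equiv theta}) in
  let: (y, t) := repr (q : {eq_quot SU_equiv theta}) in
  SU_class theta x (s * alpha (x^-1 * y) t).

Lemma coord_star p q g : coord (star p q) g = coord p g * coord q g.
Proof.
rewrite /star [coord p g]/coord [coord q g]/coord.
by case: (repr _) => x s; case: (repr _) => y t; exact: coord_mul.
Qed.

Lemma starA : associative star.
Proof.
by move=> p q r; apply: coord_inj; apply/funext => g; rewrite !coord_star mulgA.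
Qed.

Lemma star_class x s y t :
  star (SU_class theta x s) (SU_class theta y t) =
  SU_class theta x (s * alpha (x^-1 * y) t).
Proof.
apply: coord_inj; apply/funext => g.
by rewrite coord_star coord_mul !coord_class.
Qed.

Lemma star_formula_star : star_formula one star.
Proof.
move=> x s y t; exists (alpha (x^-1 * y) t); last exact: star_class.
by rewrite -pact_alpha invgM invgK.
Qed.

Lemma coord_act x p g : coord (SU_act_fun x p) g = coord p (x^-1 * g).
Proof.
elim/(@SU_ind _ _ theta): p => y s.
by rewrite SU_act_funE !coord_class invgM invgK mulgA.
Qed.

Lemma SU_act_funM x : {morph @SU_act_fun _ _ theta x : p q / star p q}.
Proof.
move=> p q; apply: coord_inj; apply/funext => g.
by rewrite !(coord_star, coord_act).
Qed.

(** * The globalization *)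

Let T : semigroupType := SU_semigroup starA.

Lemma SU_class_inj x s t :
  SU_class theta x s = SU_inj theta t <-> theta x s = Some t.
Proof. by rewrite SU_classP invg1 mul1g. Qed.

Lemma SU_injM s t : star (SU_inj theta s) (SU_inj theta t) = SU_inj theta (s * t).
Proof. by rewrite star_class mulVg alpha1. Qed.

Lemma star_injl s q : range (SU_inj theta) (star (SU_inj theta s) q).
Proof. by elim/(@SU_ind _ _ theta): q => y t; rewrite star_class; eexists. Qed.

(** In [[y, t * alpha y^-1 s]] the second entry lies in the ideal [D_(y^-1)], so
    [y] can be moved across the relation defining S^U. *)
Lemma star_injr s q : range (SU_inj theta) (star q (SU_inj theta s)).
Proof.
elim/(@SU_ind _ _ theta): q => y t; rewrite star_class mulg1.
have [u tu] : exists u, theta y (t * alpha y^-1 s) = Some u.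
  by apply: pdomV_pact; rewrite -one_alpha oneCA; exact: pdom_oneM.
by exists u => //; exact/esym/SU_class_inj.
Qed.

Lemma star_globalization :
  @is_globalization G S T theta (SU_act theta) (SU_inj theta).
Proof.
split.
- apply: (@global_in_A G T _ (@SU_act_fun _ _ theta)) => // x p q.
  exact: SU_act_funM.
- split=> [s t|x a b ab]; first exact/esym/SU_injM.
  by congr Some; rewrite SU_act_funE mulg1; apply/SU_class_inj.
- by move=> s t /SU_classP; rewrite mulVg pact1 => -[].
- move=> x a; split=> [[b ab]|[_ [<-] [b _]]].
    exists (SU_inj theta b); last by exists b.
    by congr Some; rewrite SU_act_funE mulg1; apply/SU_class_inj.
  by rewrite SU_act_funE mulg1 => /esym/SU_class_inj; exists b.
Qed.

Lemma star_ideal : @ideal T (range (SU_inj theta)).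
Proof.
by move=> _ q [s _ <-]; split; [exact: star_injl|exact: star_injr].
Qed.

Lemma star_unital : @unital T (range (SU_inj theta)).
Proof.
exists (SU_inj theta (one 1)) => [|_ [s _ <-]]; first by exists (one 1).
by split; apply: etrans (SU_injM _ _) _; rewrite -1?oneC one1M.
Qed.

End UnitalDomains.

(** * Failure of universality *)

Section NonUniversality.
Context (G : groupType).

Definition bool_and : semigroupType :=
  HB.pack bool (isSemigroup.Build bool andbA).

Definition bool_pact_fun (x : G) (a : bool_and) : option bool_and :=
  if (x == 1) || ~~ a then Some a else None.

Lemma bool_pact_eq x a b : bool_pact_fun x a = Some b -> b = a.
Proof. by rewrite /bool_pact_fun; case: ifP => // _ []. Qed.

Lemma bool_pact1 a : bool_pact_fun 1 a = Some a.
Proof. by rewrite /bool_pact_fun eqxx. Qed.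

Lemma bool_pactV x a b :
  bool_pact_fun x a = Some b -> bool_pact_fun x^-1 b = Some a.
Proof.
by move=> /[dup] /bool_pact_eq ->; rewrite /bool_pact_fun invg_eq1.
Qed.

Lemma bool_pactM x y a b c : bool_pact_fun y a = Some b ->
  bool_pact_fun x b = Some c -> bool_pact_fun (x * y) a = Some c.
Proof.
move=> /[dup] /bool_pact_eq ->; rewrite /bool_pact_fun.
case: a; rewrite ?orbT //= !orbF.
by case: eqP => // -> _; rewrite mulg1.
Qed.

Definition bool_pact : partial_action G bool_and :=
  PartialAction bool_pact1 bool_pactV bool_pactM.

Definition bool_one (x : G) : bool_and := x == 1.

Lemma bool_pdomE x a : pdom bool_pact x a <-> (x == 1) || ~~ a.
Proof.
split=> [[b ba]|xa]; last by exists a; rewrite /= /bool_pact_fun xa.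
by have := pactV ba; rewrite /= /bool_pact_fun invg_eq1; case: ifP.
Qed.

Lemma bool_in_pA : in_pA bool_pact.
Proof.
apply: in_pA_morph => x a a' b b'.
move=> /[dup] /bool_pact_eq -> + /[dup] /bool_pact_eq ->.
by rewrite /= /bool_pact_fun; case: eqP => //=; case: a; case: a'.
Qed.

Lemma bool_generates_domain x : generates_domain bool_pact x (bool_one x).
Proof.
split; first by split=> [|s]; [exact: andbb|exact: andbC].
apply/seteqP; split=> [a /bool_pdomE xa|_ [a _ <-]].
  by exists a => //; move: xa; rewrite /bool_one; case: eqP => //; case: a.
by apply/bool_pdomE; rewrite /bool_one; case: eqP.
Qed.

Lemma bool_unital_ideal_domains : unital_ideal_domains bool_pact.
Proof.
move=> x; split=> [a s|].
  rewrite !bool_pdomE; case: (x == 1) => //=.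
  by case: a => // _; case: s.
exists (bool_one x) => [|a /bool_pdomE].
  by apply/bool_pdomE; rewrite /bool_one; case: eqP.
by rewrite /bool_one; case: eqP; case: a.
Qed.

(** The left zero semigroup on the set [G], with [None] as an adjoined zero. *)
Definition left_zero0_mul (a b : option G) : option G :=
  if b is None then None else a.

Lemma left_zero0_mulA : associative left_zero0_mul.
Proof. by move=> [a|] [b|] [c|]. Qed.

Definition left_zero0 : semigroupType :=
  HB.pack (option G) (isSemigroup.Build (option G) left_zero0_mulA).

Definition left_zero0_act_fun (x : G) : left_zero0 -> left_zero0 :=
  omap (fun g => x * g).

Lemma left_zero0_act1 a : Some (left_zero0_act_fun 1 a) = Some a.
Proof. by case: a => //= a; rewrite mul1g. Qed.

Lemma left_zero0_actV x a b :
  Some (left_zero0_act_fun x a) = Some b ->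
  Some (left_zero0_act_fun x^-1 b) = Some a.
Proof. by move=> [<-]; case: a => //= a; rewrite mulKg. Qed.

Lemma left_zero0_actM x y a b c :
  Some (left_zero0_act_fun y a) = Some b ->
  Some (left_zero0_act_fun x b) = Some c ->
  Some (left_zero0_act_fun (x * y) a) = Some c.
Proof. by move=> [<-] [<-]; case: a => //= a; rewrite mulgA. Qed.

Definition left_zero0_act : partial_action G left_zero0 :=
  @PartialAction G left_zero0 (fun x a => Some (left_zero0_act_fun x a))
    left_zero0_act1 left_zero0_actV left_zero0_actM.

Definition left_zero0_inj (a : bool_and) : left_zero0 :=
  if a then Some 1 else None.

Lemma left_zero0_globalization :
  is_globalization bool_pact left_zero0_act left_zero0_inj.
Proof.
split.
- by apply: (@global_in_A _ _ _ left_zero0_act_fun) => // x [a|] [b|].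
- split=> [[] []|x a b /[dup] /bool_pact_eq ->] //=.
  rewrite /bool_pact_fun; case: eqP => [-> _|_]; last by case: a.
  exact: left_zero0_act1.
- by move=> [] [].
- move=> x a; rewrite /= /bool_pact_fun; split=> [[b]|[_ [<-]]].
    case: ifP => // xa _; exists (left_zero0_act_fun x (left_zero0_inj a)) => //.
    exists a => //; case: a xa => //=; rewrite orbF => /eqP ->.
    by rewrite mulg1.
  case: a => [[[] //= _ []]|_]; last by exists false; rewrite orbT.
  by rewrite mulg1 => <-; exists true; rewrite eqxx.
Qed.

(** With [g <> 1], a morphism out of S^U extending [left_zero0_inj] would have to
    send [[1,1] * [g,1] = [1,0]] both to 0 and to [1_G * g = 1_G]. *)
Lemma star_not_universal (g : G)
    (op : SU bool_pact -> SU bool_pact -> SU bool_pact) (opA : associative op) :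
  g != 1 -> star_formula bool_one op ->
  ~ @is_universal_globalization G bool_and (SU_semigroup opA) bool_pact
      (SU_act bool_pact) (SU_inj bool_pact).
Proof.
move=> g1 op_star [_ /(_ _ _ _ left_zero0_globalization)].
move=> [psi [[[psiM psi_act] psi_inj] _]].
have [u uE opE] := op_star 1 true g true.
have u0 : u = false.
  move: uE => /bool_pact_eq ->.
  by rewrite /bool_one mulg1 invg_eq1 (negPf g1).
have := psiM (SU_class bool_pact 1 true) (SU_class bool_pact g true).
have -> : SU_class bool_pact g true = SU_act_fun g (SU_inj bool_pact true).
  by rewrite SU_act_funE mulg1.
have [<-] := psi_act g (SU_inj bool_pact true) _ erefl.
rewrite SU_act_funE mulg1 [X in psi X = _]opE u0.
by rewrite (psi_inj false) (psi_inj true).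
Qed.

End NonUniversality.

Definition bool_xor : groupType :=
  HB.pack bool (isGroup.Build bool addbA addFb addbF addbb addbb).

Theorem theorem5p5 :
  (forall (G : groupType) (S : semigroupType) (theta : partial_action G S),
    in_pA theta -> unital_ideal_domains theta ->
    (forall x, exists e, generates_domain theta x e) /\
    (forall one : G -> S, (forall x, generates_domain theta x (one x)) ->
      exists (op : SU theta -> SU theta -> SU theta) (opA : associative op),
        let T := SU_semigroup opA in
        [/\ star_formula one op,
            @is_globalization G S T theta (SU_act theta) (SU_inj theta),
            @ideal T (range (SU_inj theta)) &
            @unital T (range (SU_inj theta))]))
  /\
  (exists (G : groupType) (S : semigroupType) (theta : partial_action G S),
    [/\ in_pA theta, unital_ideal_domains theta &
      exists one : G -> S, (forall x, generates_domain theta x (one x)) /\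
      exists (op : SU theta -> SU theta -> SU theta) (opA : associative op),
        star_formula one op /\
        ~ @is_universal_globalization G S (SU_semigroup opA) theta
            (SU_act theta) (SU_inj theta)]).
Proof.
split=> [G S theta pA domP|].
  split=> [x|one oneP].
    by have [idx unx] := domP x; exact: unital_ideal_generated.
  exists (star one), (starA pA oneP); split.
  - exact: star_formula_star.
  - exact: star_globalization.
  - exact: star_ideal.
  - exact: star_unital.
exists bool_xor, bool_and, (bool_pact bool_xor); split.
- exact: bool_in_pA.
- exact: bool_unital_ideal_domains.
exists (@bool_one bool_xor); split; first exact: bool_generates_domain.
have pA := bool_in_pA bool_xor; have oneP := @bool_generates_domain bool_xor.
exists (star (@bool_one bool_xor)), (starA pA oneP).
have starP := star_formula_star pA oneP.
by split=> //; apply: (@star_not_universal bool_xor true).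
Qed.
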